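(* The solutions $s_1^{\mathrm{cleaned}},\ldots,s_n^{\mathrm{cleaned}}$ of the optimization problem $$\min_{s_1^{\mathrm{clean}},\ldots,s_n^{\mathrm{clean}}}\ \bigl\|\mathbf{U}\,\mathrm{diag}(s_1^{\mathrm{clean}},\ldots,s_n^{\mathrm{clean}})\,\mathbf{V}'-\mathcal{C}\bigr\|_{\mathrm F}$$ satisfy $$s_k^{\mathrm{cleaned}}=\mathbf{u}_k'\,\mathcal{C}\,\mathbf{v}_k\approx\frac{\operatorname{Im}L(z)}{\operatorname{Im}(zG(z))}\qquad\text{for } z=s_k+\mathrm{i}\eta,\ \text{with } \eta\ll1.$$ More precisely, for any $\varepsilon>0$ such that $[s_k-\varepsilon,s_k+\varepsilon]\cap\{s_1,\ldots,s_n\}=\{s_k\}$, $$s_k^{\mathrm{cleaned}}=\mathbf{u}_k'\,\mathcal{C}\,\mathbf{v}_k=\lim_{\eta\to 0}\frac{\int_{s_k-\varepsilon}^{s_k+\varepsilon}\operatorname{Im} L(x+\mathrm{i}\eta)\,\mathrm{d}x}{\int_{s_k-\varepsilon}^{s_k+\varepsilon}\operatorname{Im}\bigl((x+\mathrm{i}\eta)\,G(x+\mathrm{i}\eta)\bigr)\,\mathrm{d}x}.$$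
   Context: $M'$ denotes the transpose of a matrix $M$ and $\|M\|_{\mathrm F}=\sqrt{\operatorname{Tr}MM'}$ its Frobenius norm. Let $n\le p$ and let $(X,Y)\in\mathbb{R}^n\times\mathbb{R}^p$ be a pair of column random vectors such that the concatenated vector $\begin{pmatrix}X\\ Y\end{pmatrix}$ is centered Gaussian with covariance $\Sigma=\begin{pmatrix}\mathcal{A}&\mathcal{C}\\ \mathcal{C}'&\mathcal{B}\end{pmatrix}$, a symmetric non-negative definite $(n+p)\times(n+p)$ matrix; so $\mathcal{C}=\mathbb{E}XY'\in\mathbb{R}^{n\times p}$ is the true cross-covariance matrix. Let $(X(1),Y(1)),\ldots,(X(T),Y(T))$ be independent copies of $(X,Y)$, $\mathbf{X}=[X(1)\cdots X(T)]\in\mathbb{R}^{n\times T}$, $\mathbf{Y}=[Y(1)\cdots Y(T)]\in\mathbb{R}^{p\times T}$, and let $\mathbf{C}_{XY}=\frac1T\mathbf{X}\mathbf{Y}'$ be the empirical cross-covariance matrix. The singular value decomposition of $\mathbf{C}_{XY}$ is $\mathbf{C}_{XY}=\sum_{k=1}^n s_k\mathbf{u}_k\mathbf{v}_k'=\mathbf{U}\,\mathrm{diag}(s_1,\ldots,s_n)\mathbf{V}'$, with $s_1,\ldots,s_n\ge0$, $\mathbf{u}_1,\ldots,\mathbf{u}_n$ orthonormal column vectors in $\mathbb{R}^n$, $\mathbf{v}_1,\ldots,\mathbf{v}_n$ orthonormal column vectors in $\mathbb{R}^p$, $\mathbf{U}=[\mathbf{u}_1\cdots\mathbf{u}_n]$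 and $\mathbf{V}=[\mathbf{v}_1\cdots\mathbf{v}_n]$. For $z\in\mathbb{C}\setminus\mathbb{R}$ set $\mathbf{G}=(z^2-\mathbf{C}_{XY}\mathbf{C}_{XY}')^{-1}$, $G(z)=\frac1T\operatorname{Tr}\mathbf{G}$ and $L(z)=\frac1T\operatorname{Tr}\bigl(\mathbf{G}\,\mathbf{C}_{XY}\,\mathcal{C}'\bigr)$.
   Formalization: Both limits are asserted only when s_k > 0, s_k is not repeated among s_1,…,s_n, and (for the integrals) ε < 2 s_k; otherwise they fail in general (the pole at −s_k interferes, L has no pole at 0, or an average appears). The approximation is read as the limit η→0. *)

(* Defs.v *)
From HB Require Import structures.
From mathcomp Require Export all_boot all_order all_algebra.
From mathcomp Require Export all_classical all_reals all_analysis.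
From mathcomp Require Export complex.

Set Implicit Arguments.
Unset Strict Implicit.
Unset Printing Implicit Defensive.

Export Order.TTheory GRing.Theory Num.Theory.
Export numFieldNormedType.Exports.

Local Open Scope classical_set_scope.
Local Open Scope ring_scope.

Section RandomVectors.
Context {R : realType}.

(* The Borel sigma-algebra of R^N, generated by the N coordinate maps. *)
Definition borel_cV (N : nat) : set (set 'cV[R]_N) :=
  g_sigma_preimage (fun (i : 'I_N) (v : 'cV[R]_N) => (v i 0 : measurableTypeR R)).

Definition random_vector d (Omega : measurableType d) (N : nat)
    (Z : Omega -> 'cV[R]_N) : Prop :=
  forall B, borel_cV B -> measurable (Z @^-1` B).

(* N(0, v).  The library's normal_prob m 0 is not the Dirac mass at m (it is
   the uniform law on [0, 1]), hence the case distinction. *)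
Definition centered_normal (v : R) (B : set (measurableTypeR R)) : \bar R :=
  if v == 0 then \d_(0 : measurableTypeR R) B else normal_prob 0 (Num.sqrt v) B.

(* Possibly degenerate Gaussian vectors: every linear form a' Z is N(0, a' S a). *)
Definition centered_gaussian d (Omega : measurableType d)
    (P : probability Omega R) (N : nat) (Z : Omega -> 'cV[R]_N)
    (S : 'M[R]_N) : Prop :=
  random_vector Z /\
  forall (a : 'cV[R]_N) (B : set (measurableTypeR R)), measurable B ->
    P [set w | B ((a^T *m Z w) 0 0)] = centered_normal ((a^T *m S *m a) 0 0) B.

Definition same_law d (Omega : measurableType d) (P : probability Omega R)
    d' (Omega' : measurableType d') (P' : probability Omega' R) (N : nat)
    (Z : Omega -> 'cV[R]_N) (Z' : Omega' -> 'cV[R]_N) : Prop :=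
  forall B, borel_cV B -> P (Z @^-1` B) = P' (Z' @^-1` B).

(* Taking some of the B t to be setT gives the product rule for subfamilies. *)
Definition mutually_independent d (Omega : measurableType d)
    (P : probability Omega R) (N T : nat) (Z : 'I_T -> Omega -> 'cV[R]_N) : Prop :=
  forall B : 'I_T -> set 'cV[R]_N, (forall t, borel_cV (B t)) ->
    P (\bigcap_(t in setT) (Z t @^-1` B t)) = (\prod_(t < T) P (Z t @^-1` B t))%E.

Definition independent_copies d0 (Omega0 : measurableType d0)
    (P0 : probability Omega0 R) d (Omega : measurableType d)
    (P : probability Omega R) (N T : nat) (Z0 : Omega0 -> 'cV[R]_N)
    (Z : 'I_T -> Omega -> 'cV[R]_N) : Prop :=
  [/\ forall t, random_vector (Z t),
      forall t, same_law P P0 (Z t) Z0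
    & mutually_independent P Z].

End RandomVectors.

Section Matrices.
Context {R : realType}.

Definition nonneg_definite (N : nat) (S : 'M[R]_N) : Prop :=
  S^T = S /\ forall a : 'cV[R]_N, 0 <= (a^T *m S *m a) 0 0.

Definition frobenius (m n : nat) (M : 'M[R]_(m, n)) : R :=
  Num.sqrt (\tr (M *m M^T)).

Definition data_matrix (Omega : Type) (m T : nat) (X : 'I_T -> Omega -> 'cV[R]_m)
    (w : Omega) : 'M[R]_(m, T) :=
  \matrix_(i, t) X t w i 0.

Definition empirical_cross_cov (Omega : Type) (n p T : nat)
    (X : 'I_T -> Omega -> 'cV[R]_n) (Y : 'I_T -> Omega -> 'cV[R]_p)
    (w : Omega) : 'M[R]_(n, p) :=
  T%:R^-1 *: (data_matrix X w *m (data_matrix Y w)^T).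

Definition is_svd (n p : nat) (M : 'M[R]_(n, p))
    (U : 'M[R]_n) (s : 'rV[R]_n) (V : 'M[R]_(p, n)) : Prop :=
  [/\ forall k, 0 <= s 0 k,
      U^T *m U = 1%:M,
      V^T *m V = 1%:M
    & M = U *m diag_mx s *m V^T].

Definition is_cleaned (n p : nat) (U : 'M[R]_n) (V : 'M[R]_(p, n))
    (C : 'M[R]_(n, p)) (sc : 'rV[R]_n) : Prop :=
  forall s' : 'rV[R]_n,
    frobenius (U *m diag_mx sc *m V^T - C)
    <= frobenius (U *m diag_mx s' *m V^T - C).

Definition to_complex (m n : nat) (M : 'M[R]_(m, n)) : 'M[R[i]]_(m, n) :=
  map_mx (real_complex R) M.

Definition resolvent (n p : nat) (M : 'M[R]_(n, p)) (z : R[i]) : 'M[R[i]]_n :=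
  invmx ((z ^+ 2)%:M - to_complex (M *m M^T)).

Definition Gfun (T n p : nat) (M : 'M[R]_(n, p)) (z : R[i]) : R[i] :=
  T%:R^-1 * \tr (resolvent M z).

Definition Lfun (T n p : nat) (M C : 'M[R]_(n, p)) (z : R[i]) : R[i] :=
  T%:R^-1 * \tr (resolvent M z *m to_complex M *m to_complex C^T).

(* In the ratios below only Im L and Im (z G) with z = x + i eta occur; as
   L(z^* ) = L(z)^* and likewise for z G, they are even in eta, so that the
   limit eta -> 0 may be taken over eta <> 0 of either sign. *)
Definition pointwise_ratio (T n p : nat) (M C : 'M[R]_(n, p)) (x eta : R) : R :=
  complex.Im (Lfun T M C (Complex x eta))
  / complex.Im (Complex x eta * Gfun T M (Complex x eta)).

Definition integral_ratio (T n p : nat) (M C : 'M[R]_(n, p)) (a b eta : R) : R :=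
  (\int[lebesgue_measure]_(x in `[a, b])
      complex.Im (Lfun T M C (Complex x eta)))
  / (\int[lebesgue_measure]_(x in `[a, b])
      complex.Im (Complex x eta * Gfun T M (Complex x eta))).

(* The poles of L and z G are the points s_j and - s_j.  If m indices j share
   the value s_k, the limits are the average of u_j' C v_j over these indices;
   if - s_k lies in [s_k - eps, s_k + eps], its residue, of opposite sign in L
   and of equal sign in z G, spoils the second limit (and if s_k = 0, L has no
   pole there at all).  Hence the conditions simple_at, 0 < s_k and
   eps < 2 s_k under which the limits are asserted. *)
Definition simple_at (n : nat) (s : 'rV[R]_n) (k : 'I_n) : Prop :=
  forall j, s 0 j = s 0 k -> j = k.

End Matrices.

(* Main.v *)
(* By Pythagoras, the objective is |s' - c|^2 plus a constant, with
   c_j = u_j' C v_j, so c is the unique minimizer.  The SVD diagonalizes the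
   resolvent, and partial fractions turn Im L and Im (z G) at z = x + i eta into
   -1/(2T) times sums of Lorentzians centred at the s_j (weights c_j and 1) and
   at the - s_j (weights - c_j and 1).  Multiplied by eta (resp. by sgn eta after
   integration), the Lorentzian at d tends to [d = 0] (resp. to pi or 0 according
   to whether its centre is inside or outside the interval), so only the pole
   s_k survives in both ratios. *)
Require Import Defs.
From mathcomp Require Import ring lra.

Set Implicit Arguments.
Unset Strict Implicit.
Unset Printing Implicit Defensive.

Local Open Scope classical_set_scope.
Local Open Scope ring_scope.

(** * The least-squares problem in Frobenius norm *)

Lemma mxtrace_tr_sqr_ge0 (R : realDomainType) (m q : nat) (M : 'M[R]_(m, q)) :
  0 <= \tr (M *m M^T).
Proof.
apply: sumr_ge0 => i _; rewrite mxE; apply: sumr_ge0 => j _.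
by rewrite mxE -expr2 sqr_ge0.
Qed.

Section Cleaning.
Context {R : realType} {n p : nat}.
Variables (U : 'M[R]_n) (V : 'M[R]_(p, n)).
Hypotheses (UtU : U^T *m U = 1%:M) (VtV : V^T *m V = 1%:M).

Definition overlap (C : 'M[R]_(n, p)) : 'rV[R]_n :=
  \row_k (U^T *m C *m V) k k.

Lemma overlapE C k : overlap C 0 k = ((col k U)^T *m C *m col k V) 0 0.
Proof.
rewrite !mxE; apply: eq_bigr => j _; rewrite !mxE; congr (_ * _).
by apply: eq_bigr => i _; rewrite !mxE.
Qed.

(** For the inner product Tr(M N'), the residual of C after subtracting U diag(c) V' is orthogonal
    to every U diag(e) V', since Tr(U diag(e) V' C') is the sum of e_k c_k. The cross terms
    therefore vanish, and orthonormality makes U diag(e) V' as long as e. *)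
Lemma pythagoras_cleaning (C : 'M[R]_(n, p)) (s : 'rV[R]_n) :
  let D := U *m diag_mx s *m V^T - C in
  let D0 := U *m diag_mx (overlap C) *m V^T - C in
  \tr (D *m D^T) = \sum_k (s 0 k - overlap C 0 k) ^+ 2 + \tr (D0 *m D0^T).
Proof.
set e := s - overlap C => /=.
set E := U *m diag_mx e *m V^T; set D0 := _ *m diag_mx (overlap C) *m _ - C.
have -> : U *m diag_mx s *m V^T - C = E + D0.
  rewrite /E /D0 addrA -mulmxDl -mulmxDr -linearD /=.
  by rewrite /e subrK.
have EE : \tr (E *m E^T) = \sum_k (s 0 k - overlap C 0 k) ^+ 2.
  rewrite /E !trmx_mul trmxK tr_diag_mx.
  rewrite -!mulmxA (mulmxA V^T) VtV mul1mx mxtrace_mulC -!mulmxA UtU mulmx1.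
  rewrite mulmx_diag mxtrace_diag; apply: eq_bigr => k _.
  by rewrite !mxE -expr2.
have ED : \tr (E *m D0^T) = 0.
  rewrite /E /D0 [(_ - C)^T]linearB /= !trmx_mul trmxK tr_diag_mx mulmxBr.
  rewrite [\tr (_ - _)]linearB /= -!mulmxA (mulmxA V^T) VtV mul1mx.
  rewrite mxtrace_mulC -!mulmxA UtU mulmx1.
  rewrite [X in _ - X]mxtrace_mulC -!mulmxA.
  have -> : V^T *m (C^T *m U) = (U^T *m C *m V)^T by rewrite !trmx_mul trmxK.
  rewrite mulmx_diag mxtrace_diag mul_diag_mx -sumrB big1 // => k _.
  by rewrite !mxE subrr.
clearbody E D0.
have DE : \tr (D0 *m E^T) = 0 by rewrite -mxtrace_tr trmx_mul trmxK ED.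
by rewrite linearD /= mulmxDl !mulmxDr !linearD /= EE ED DE addr0 add0r.
Qed.

(** Minimality tested against c itself forces the sum of squares of s_k - c_k to be at most 0, hence
    termwise 0. *)
Lemma is_cleanedP (C : 'M[R]_(n, p)) (s : 'rV[R]_n) :
  is_cleaned U V C s <-> s = overlap C.
Proof.
split=> [/(_ (overlap C))|-> s'].
  rewrite /frobenius ler_sqrt ?mxtrace_tr_sqr_ge0 // pythagoras_cleaning.
  rewrite gerDr => le0.
  have /eqP : \sum_k (s 0 k - overlap C 0 k) ^+ 2 = 0.
    by apply/eqP; rewrite eq_le le0 sumr_ge0 // => k _; rewrite sqr_ge0.
  rewrite psumr_eq0 => [/allP h|k _]; last exact: sqr_ge0.
  apply/rowP => k; have := h k (mem_index_enum k).
  by rewrite sqrf_eq0 subr_eq0 => /eqP.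
rewrite /frobenius ler_sqrt ?mxtrace_tr_sqr_ge0 // (pythagoras_cleaning C s').
by rewrite lerDr sumr_ge0 // => k _; rewrite sqr_ge0.
Qed.

End Cleaning.

(** * Limits of sums and of quotients *)

Section Limits.
Context {R : realType}.

Lemma cvg_big_sum (T : Type) (F : set_system T) (FF : Filter F) (I : Type)
    (r : seq I) (f : I -> T -> R) (l : I -> R) :
  (forall i, f i t @[t --> F] --> l i) ->
  \sum_(i <- r) f i t @[t --> F] --> \sum_(i <- r) l i.
Proof.
move=> fl; elim: r => [|i r IHr].
  by rewrite big_nil; under eq_fun do rewrite big_nil; exact: cvg_cst.
rewrite big_cons; under eq_fun do rewrite big_cons.
exact: cvgD (fl i) IHr.
Qed.

(** Numerator and denominator need not converge separately: in the pointwise ratio they can grow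
    like 1/eta, and the integrals are odd in eta. A common factor g, [eta] or [Num.sg eta], repairs
    both at once. *)
Lemma cvg_common_factor (T : Type) (F : set_system T) (FF : Filter F)
    (g N D : T -> R) (c d : R) :
  (\forall t \near F, g t != 0) -> d != 0 ->
  g t * N t @[t --> F] --> c * d -> g t * D t @[t --> F] --> d ->
  N t / D t @[t --> F] --> c.
Proof.
move=> g0 d0 gN gD; rewrite -[c](mulfK d0).
apply: cvg_trans (cvgM gN (cvgV d0 gD)); apply: near_eq_cvg.
near=> t => /=.
have gt0 : g t != 0 by near: t.
by rewrite invfM mulrACA divff ?mul1r.
Unshelve. all: by end_near.
Qed.

End Limits.

(** * Lorentzians, their primitives and their concentration as eta tends to 0 *)

Section Lorentz.
Context {R : realType}.
Implicit Types (x eta d a b c : R).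

(** This is pi times the Poisson kernel of the half-plane, that is - Im of 1/(x + i eta); it is odd
    in eta. *)
Definition lorentz eta x : R := eta / (x ^+ 2 + eta ^+ 2).

Lemma lorentz_den_gt0 eta x : eta != 0 -> 0 < x ^+ 2 + eta ^+ 2.
Proof.
by move=> eta0; rewrite ltr_wpDl ?sqr_ge0 // exprn_even_gt0.
Qed.

Lemma continuous_lorentz eta c : eta != 0 ->
  continuous (fun x => lorentz eta (x - c)).
Proof.
move=> eta0 x; apply: cvgM; first exact: cvg_cst.
apply: cvgV; first by rewrite gt_eqF // lorentz_den_gt0.
apply: cvgD; last exact: cvg_cst.
apply: (@cvgM _ _ _ _ (fun y => y - c) (fun y => y - c));
  by apply: cvgB; [exact: cvg_id|exact: cvg_cst].
Qed.

Lemma is_derive_atan_lorentz eta c x : eta != 0 ->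
  is_derive x 1 (fun y => atan ((y - c) / eta)) (lorentz eta (x - c)).
Proof.
move=> eta0.
have -> : lorentz eta (x - c) = (1 + ((x - c) / eta) ^+ 2)^-1 * eta^-1.
  rewrite /lorentz; field.
  have den0 := lorentz_den_gt0 (x - c) eta0.
  by rewrite eta0 /= addrC gt_eqF.
have h : is_derive x 1 (fun y => (y - c) / eta) eta^-1.
  apply: is_derive_eq.
  by rewrite scaler0 add0r subr0 /GRing.scale /= mulr1.
exact: (is_derive1_comp (f := atan) (is_derive1_atan _) h).
Qed.

Lemma Rintegral_lorentz_sum (I : Type) (r : seq I) (w c : I -> R) eta a b :
  eta != 0 -> a < b ->
  \int[lebesgue_measure]_(x in `[a, b]) (\sum_(i <- r) w i * lorentz eta (x - c i))
  = \sum_(i <- r) w i * (atan ((b - c i) / eta) - atan ((a - c i) / eta)).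
Proof.
move=> eta0 ab.
(* One primitive for the whole sum: the fundamental theorem of calculus is applied once, without
   splitting the integral. It is valid for either sign of eta. *)
pose F x : R := \sum_(i <- r) w i * atan ((x - c i) / eta).
have dF x : is_derive x 1 F (\sum_(i <- r) w i * lorentz eta (x - c i)).
  rewrite /F; elim: r {F} => [|i r IHr].
    by rewrite big_nil; under eq_fun do rewrite big_nil; exact: is_derive_cst.
  rewrite big_cons; under eq_fun do rewrite big_cons.
  apply: (is_deriveD (f := fun y => w i * atan ((y - c i) / eta))).
  have := is_derive_atan_lorentz (c i) x eta0.
  exact: is_deriveZ.
have cF x : {for x, continuous F}.
  exact/differentiable_continuous/derivable1_diffP.
have -> : \sum_(i <- r) w i * (atan ((b - c i) / eta) - atan ((a - c i) / eta))
    = F b - F a.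
  by rewrite /F -sumrB; apply: eq_bigr => i _; rewrite mulrBr.
rewrite /Rintegral (@continuous_FTC2 _ _ F) //.
- apply: continuous_in_subspaceT => x _; apply: cvg_big_sum => i.
  apply: cvgM; first exact: cvg_cst.
  exact: continuous_lorentz.
- split; last by apply: cvg_at_left_filter; exact: cF.
    by move=> x _; exact: ex_derive.
  by apply: cvg_at_right_filter; exact: cF.
- by move=> x _; rewrite derive1E; exact: derive_val.
Qed.

Lemma cvg_lorentz0 d :
  eta * lorentz eta d @[eta --> (0 : R)^'] --> ((d == 0)%:R : R).
Proof.
have [->|d0] := eqVneq d 0.
  apply: cvg_near_cst; near=> eta.
  have eta0 : eta != 0 by near: eta; exact: nbhs_dnbhs_neq.
  by rewrite /lorentz expr0n add0r mulrA -expr2 divff // sqrf_eq0.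
apply: cvg_within_filter.
have sq0 : eta ^+ 2 @[eta --> (0 : R)] --> (0 : R).
  rewrite -[X in _ --> X](expr0n R 2); exact: exprn_continuous.
(* For d nonzero the function is continuous at eta = 0; its value there is written in the shape of
   the function, so that the limit is taken factor by factor. *)
have -> : false%:R = 0 * (0 / (d ^+ 2 + 0)) :> R by rewrite mul0r.
apply: cvgM; first exact: cvg_id.
apply: cvgM; first exact: cvg_id.
apply: cvgV; first by rewrite addr0 sqrf_eq0.
by apply: cvgD; [exact: cvg_cst|exact: sq0].
Unshelve. all: by end_near.
Qed.

Lemma cvg_atan_div_norm d :
  atan (d / `|eta|) @[eta --> (0 : R)^'] --> Num.sg d * (pi / 2).
Proof.
have pos c : 0 < c -> atan (c / `|eta|) @[eta --> (0 : R)^'] --> (pi / 2 : R).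
  move=> c0; apply: (@cvg_comp _ _ _ (fun eta : R => c / `|eta|) atan
    _ (pinfty_nbhs R) _ _ (@cvgy_atan R)).
  apply/cvgryPge => A.
  near=> eta.
  have eta0 : eta != 0 by near: eta; exact: nbhs_dnbhs_neq.
  rewrite ler_pdivlMr ?normr_gt0 //.
  (* This bound gives A |eta| <= (|A| + 1) |eta| <= c; the summand 1 keeps the divisor positive. *)
  have : `|eta| <= c / (`|A| + 1).
    by near: eta; apply: dnbhs0_le; rewrite divr_gt0 // ltr_wpDl.
  rewrite ler_pdivlMr ?ltr_wpDl // => /(le_trans _); apply.
  rewrite mulrC ler_wpM2l //.
  by rewrite (le_trans (ler_norm A)) // lerDl.
have [d0|d0|->] := ltrgtP d 0.
- rewrite ltr0_sg // mulN1r.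
  have d'0 : 0 < - d by rewrite oppr_gt0.
  suff -> : (fun eta => atan (d / `|eta|)) = (fun eta => - atan (- d / `|eta|)).
    exact: cvgN (pos _ d'0).
  by apply/funext => eta; rewrite mulNr atanN opprK.
- by rewrite gtr0_sg // mul1r; apply: pos.
- rewrite sgr0 mul0r; under eq_fun do rewrite mul0r atan0; exact: cvg_cst.
Unshelve. all: by end_near.
Qed.

(** Since atan is odd, the sign replaces eta by its absolute value, so that a two-sided limit
    exists. At eta = 0 both sides are 0, by [sgr0] and [invr0]. *)
Lemma sg_atan_div d eta : Num.sg eta * atan (d / eta) = atan (d / `|eta|).
Proof.
have [e0|e0|->] := ltrgtP eta 0.
- by rewrite ltr0_sg // mulN1r -atanN ltr0_norm // invrN mulrN.
- by rewrite gtr0_sg // mul1r gtr0_norm.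
- by rewrite sgr0 mul0r normr0 invr0 mulr0 atan0.
Qed.

End Lorentz.

(** * Sums of Lorentzians over the poles s_j and - s_j *)

Section PoleSums.
Context {R : realType} {n : nat}.
Implicit Types (s w : 'rV[R]_n) (sigma x eta : R).

(** Here [sigma] is the relative sign of the residue at - s_j: -1 for L and 1 for z G. Both
    imaginary parts thus become instances of one expression. *)
Definition pole_sum s w sigma x eta : R :=
  \sum_j w 0 j * (lorentz eta (x - s 0 j) + sigma * lorentz eta (x + s 0 j)).

(** Merging the two families of poles over a sum type makes the results on Lorentzians with
    arbitrary centres applicable. *)
Lemma pole_sumE s w sigma x eta : pole_sum s w sigma x eta =
  \sum_(i <- index_enum ('I_n + 'I_n)%type)
    (match i with inl j => w 0 j | inr j => sigma * w 0 j end) *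
    lorentz eta (x - match i with inl j => s 0 j | inr j => - s 0 j end).
Proof.
rewrite big_sumType /= -big_split /=; apply: eq_bigr => j _.
by rewrite opprK mulrDr mulrA (mulrC sigma).
Qed.

Lemma cvg_pole_sum s w sigma k : (forall j, 0 <= s 0 j) -> 0 < s 0 k ->
  simple_at s k ->
  eta * pole_sum s w sigma (s 0 k) eta @[eta --> (0 : R)^'] --> w 0 k.
Proof.
move=> s_ge0 sk_gt0 sk_simple.
under eq_fun do rewrite pole_sumE mulr_sumr.
under eq_fun do under eq_bigr do rewrite mulrCA.
have -> : w 0 k = \sum_(i <- index_enum ('I_n + 'I_n)%type)
    (match i with inl j => w 0 j | inr j => sigma * w 0 j end) *
    (s 0 k - match i with inl j => s 0 j | inr j => - s 0 j end == 0)%:R.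
  (* No mirrored pole sits at s_k because s_k + s_j > 0; among the s_j, simplicity leaves only j =
     k. *)
  rewrite big_sumType /= [X in _ + X]big1 ?addr0 => [|j _]; last first.
    by rewrite opprK gt_eqF ?mulr0 // ltr_wpDr.
  rewrite (bigD1 k) //= subrr eqxx mulr1 big1 ?addr0 // => j jk.
  have /negPf -> : s 0 k - s 0 j != 0; last by rewrite mulr0.
  by rewrite subr_eq0; apply: contra_neq jk => /esym /sk_simple.
apply: cvg_big_sum => i; apply: cvgM; first exact: cvg_cst.
exact: cvg_lorentz0.
Qed.

Lemma cvg_Rintegral_pole_sum s w sigma k e : (forall j, 0 <= s 0 j) ->
  0 < s 0 k -> 0 < e ->
  (forall j, j != k -> e < `|s 0 k - s 0 j|) -> e < 2 * s 0 k ->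
  Num.sg eta * \int[lebesgue_measure]_(x in `[s 0 k - e, s 0 k + e])
    pole_sum s w sigma x eta @[eta --> (0 : R)^'] --> w 0 k * pi.
Proof.
move=> s_ge0 sk_gt0 e0 gap e2.
pose c (i : 'I_n + 'I_n) := match i with inl j => s 0 j | inr j => - s 0 j end.
pose v (i : 'I_n + 'I_n) := match i with inl j => w 0 j | inr j => sigma * w 0 j end.
have -> : w 0 k * pi = \sum_(i <- index_enum ('I_n + 'I_n)%type)
    v i * (Num.sg (s 0 k + e - c i) * (pi / 2)
           - Num.sg (s 0 k - e - c i) * (pi / 2)).
  (* A centre outside the interval sees both endpoints on the same side, so its two limits
     cancel. *)
  have off y z : 0 < y * z -> Num.sg y * (pi / 2) - Num.sg z * (pi / 2) = 0 :> R.
    have [y0|y0|->] := ltrgtP y 0; last by rewrite mul0r ltxx.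
      by rewrite nmulr_rgt0 // => z0; rewrite !ltr0_sg // subrr.
    by rewrite pmulr_rgt0 // => z0; rewrite !gtr0_sg // subrr.
  rewrite big_sumType /= [X in _ + X]big1 ?addr0 => [|j _]; last first.
    rewrite off ?mulr0 // opprK mulr_gt0 //; first by have := s_ge0 j; lra.
    (* It remains to see that - s_j lies to the left of the interval. For j = k this is e < 2 s_k;
       otherwise e < |s_k - s_j| <= s_k + s_j. *)
    have [->|jk] := eqVneq j k; first lra.
    have := gap j jk; have := s_ge0 j.
    by case: (lerP (s 0 j) (s 0 k)); lra.
  rewrite (bigD1 k) //= big1 ?addr0 => [|j jk]; last first.
    rewrite off ?mulr0 //; have := gap j jk.
    case: (lerP (s 0 j) (s 0 k)) => _ h.
      by rewrite mulr_gt0 //; lra.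
    by rewrite -mulrNN mulr_gt0 //; lra.
  (* The centre s_k has the endpoints on opposite sides, which gives pi/2 + pi/2. *)
  rewrite gtr0_sg; last lra.
  rewrite ltr0_sg; last lra.
  by congr (_ * _); lra.
have step eta : eta != 0 -> Num.sg eta *
    \int[lebesgue_measure]_(x in `[s 0 k - e, s 0 k + e]) pole_sum s w sigma x eta
    = \sum_(i <- index_enum ('I_n + 'I_n)%type)
      v i * (atan ((s 0 k + e - c i) / `|eta|) - atan ((s 0 k - e - c i) / `|eta|)).
  move=> eta0; under eq_Rintegral do rewrite pole_sumE.
  rewrite (Rintegral_lorentz_sum _ v c eta0); last lra.
  rewrite mulr_sumr; apply: eq_bigr => i _.
  by rewrite mulrCA mulrBr !sg_atan_div.
apply: cvg_trans.
  apply: near_eq_cvg; near=> eta; symmetry; apply: step.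
  by near: eta; exact: nbhs_dnbhs_neq.
apply: cvg_big_sum => i; apply: cvgM; first exact: cvg_cst.
by apply: cvgB; exact: cvg_atan_div_norm.
Unshelve. all: by end_near.
Qed.

End PoleSums.

(** * Imaginary parts and non-vanishing off the real axis *)

Section ImaginaryParts.
Context {R : rcfType}.
Implicit Types (x eta a sigma : R).

Lemma Im_add (u v : R[i]) : complex.Im (u + v) = complex.Im u + complex.Im v.
Proof. by case: u v => ? ? [? ?]. Qed.

Lemma Im_sum (I : Type) (r : seq I) (f : I -> R[i]) :
  complex.Im (\sum_(i <- r) f i) = \sum_(i <- r) complex.Im (f i).
Proof. exact: (big_morph _ Im_add). Qed.

Lemma Im_real_mul a (z : R[i]) :
  complex.Im (real_complex R a * z) = a * complex.Im z.
Proof. by case: z => u v /=; rewrite mul0r addr0. Qed.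

Lemma Complex_sub_real_neq0 x eta a :
  eta != 0 -> Complex x eta - real_complex R a != 0.
Proof. by move=> eta0; rewrite eq_complex /= negb_and subr0 eta0 orbT. Qed.

Lemma Complex_add_real_neq0 x eta a :
  eta != 0 -> Complex x eta + real_complex R a != 0.
Proof.
by move=> /(Complex_sub_real_neq0 x (- a)); rewrite rmorphN opprK.
Qed.

Lemma Complex_add_real x eta a :
  Complex x eta + real_complex R a = Complex (x + a) eta.
Proof. by apply/eqP; rewrite eq_complex /= addr0 !eqxx. Qed.

End ImaginaryParts.

(** * Spectral form of the resolvent and partial fractions for L and z G *)

Section Resolvent.
Context {R : realType}.
Implicit Types (x eta a sigma : R).

Lemma Im_inv_lorentz x eta : complex.Im (Complex x eta)^-1 = - lorentz eta x.
Proof. by rewrite /lorentz /= -mulNr. Qed.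

(** The parameter treats two numerators together: ((z + a) + sigma (z - a)) / 2 is z for sigma = 1
    and a for sigma = -1. Dividing by (z - a)(z + a) splits it into simple poles. *)
Lemma Im_partial_fractions x eta a sigma : eta != 0 ->
  let z := Complex x eta in let ac := real_complex R a in
  complex.Im (((z + ac) + real_complex R sigma * (z - ac)) / 2
    * (z ^+ 2 - ac ^+ 2)^-1)
  = - 2^-1 * (lorentz eta (x - a) + sigma * lorentz eta (x + a)).
Proof.
move=> eta0 z ac.
have zBa := Complex_sub_real_neq0 x a eta0.
have zDa := Complex_add_real_neq0 x a eta0.
have -> : (z + ac + real_complex R sigma * (z - ac)) / 2 * (z ^+ 2 - ac ^+ 2)^-1
    = real_complex R 2^-1 * ((z - ac)^-1 + real_complex R sigma * (z + ac)^-1).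
  by rewrite fmorphV rmorph_nat subr_sqr; field; rewrite zBa zDa.
rewrite Im_real_mul Im_add Im_real_mul -rmorphN !Complex_add_real.
by rewrite !Im_inv_lorentz; ring.
Qed.

Lemma Im_real_div x eta a : eta != 0 ->
  complex.Im (real_complex R a * (Complex x eta ^+ 2 - real_complex R a ^+ 2)^-1)
  = - 2^-1 * (lorentz eta (x - a) + (-1) * lorentz eta (x + a)).
Proof.
move=> eta0; rewrite -Im_partial_fractions //; congr (complex.Im (_ * _)).
by rewrite rmorphN1; field.
Qed.

Lemma Im_self_div x eta a : eta != 0 ->
  complex.Im (Complex x eta * (Complex x eta ^+ 2 - real_complex R a ^+ 2)^-1)
  = - 2^-1 * (lorentz eta (x - a) + 1 * lorentz eta (x + a)).
Proof.
move=> eta0; rewrite -Im_partial_fractions //; congr (complex.Im (_ * _)).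
by rewrite rmorph1; field.
Qed.

Variables (n p T : nat) (M : 'M[R]_(n, p)) (U : 'M[R]_n) (s : 'rV[R]_n)
  (V : 'M[R]_(p, n)).
Hypothesis M_svd : is_svd M U s V.

Definition resolvent_poles (z : R[i]) : 'rV[R[i]]_n :=
  \row_j (z ^+ 2 - real_complex R (s 0 j) ^+ 2)^-1.

(** As U is square, U'U = 1 also gives UU' = 1, while V'V = 1 removes V from MM'. So z^2 - MM' is
    diagonal in the basis U, with entries (z - s_j)(z + s_j), nonzero off the real axis. *)
Lemma resolvent_svd x eta : eta != 0 ->
  resolvent M (Complex x eta) =
  to_complex U *m diag_mx (resolvent_poles (Complex x eta)) *m to_complex U^T.
Proof.
move=> eta0; case: M_svd => _ UtU VtV ->; set z := Complex x eta.
have UUt := mulmx1C UtU.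
have UtUc : to_complex U^T *m to_complex U = 1%:M.
  by rewrite /to_complex -map_mxM UtU map_mx1.
have UUtc : to_complex U *m to_complex U^T = 1%:M.
  by rewrite /to_complex -map_mxM UUt map_mx1.
rewrite /resolvent; set N := (_ - _).
have N_diag : N = to_complex U *m
    diag_mx (\row_j (z ^+ 2 - real_complex R (s 0 j) ^+ 2)) *m to_complex U^T.
  rewrite /N !trmx_mul trmxK tr_diag_mx -!mulmxA (mulmxA V^T) VtV mul1mx.
  rewrite (mulmxA (diag_mx s)) mulmx_diag /to_complex !map_mxM map_diag_mx.
  rewrite -/(to_complex U) -/(to_complex U^T).
  have -> : (z ^+ 2)%:M = to_complex U *m (z ^+ 2)%:M *m to_complex U^T.
    by rewrite scalar_mxC -mulmxA UUtc mulmx1.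
  rewrite !mulmxA -mulmxBl -mulmxBr; congr (_ *m _ *m _).
  rewrite -diag_const_mx -linearB /=; congr diag_mx.
  by apply/rowP => j; rewrite !mxE rmorphM expr2.
have NK : N *m (to_complex U *m diag_mx (resolvent_poles z) *m to_complex U^T)
    = 1%:M.
  rewrite N_diag -!mulmxA (mulmxA (to_complex U^T)) UtUc mul1mx.
  rewrite (mulmxA (diag_mx _)) mulmx_diag.
  suff -> : diag_mx (\row_j ((\row_j (z ^+ 2 - real_complex R (s 0 j) ^+ 2)) 0 j *
      resolvent_poles z 0 j)) = 1%:M :> 'M[R[i]]_n by rewrite mul1mx.
  rewrite -diag_const_mx; congr diag_mx; apply/rowP => j; rewrite !mxE.
  by rewrite divff // subr_sqr mulf_neq0 ?Complex_sub_real_neq0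
    ?Complex_add_real_neq0.
(* The right inverse shows that N is a unit, without which [invmx] would return N itself. *)
have [Nu _] := mulmx1_unit NK.
by rewrite -[LHS]mulmx1 -NK mulKmx.
Qed.

Lemma Im_zGfun x eta : eta != 0 ->
  complex.Im (Complex x eta * Gfun T M (Complex x eta)) =
  pole_sum s (const_mx (- 2^-1 * T%:R^-1)) 1 x eta.
Proof.
move=> eta0; rewrite /Gfun resolvent_svd // mxtrace_mulC.
case: M_svd => _ UtU _ _.
rewrite mulmxA /to_complex -map_mxM UtU map_mx1 mul1mx mxtrace_diag.
rewrite mulrCA -(rmorph_nat (real_complex R)) -fmorphV Im_real_mul mulr_sumr Im_sum.
rewrite mulr_sumr; apply: eq_bigr => j _.
by rewrite !mxE Im_self_div //; ring.
Qed.

(** By cyclicity of the trace and U'M = diag(s) V', the j-th term is c_j s_j / (z^2 - s_j^2). The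
    factor s_j in the numerator is what gives the mirrored pole the opposite sign. *)
Lemma Im_Lfun C x eta : eta != 0 ->
  complex.Im (Lfun T M C (Complex x eta)) =
  pole_sum s ((- 2^-1 * T%:R^-1) *: overlap U V C) (-1) x eta.
Proof.
move=> eta0; rewrite /Lfun resolvent_svd //.
case: M_svd => _ UtU _ ME.
rewrite -!mulmxA mxtrace_mulC -!mulmxA
  (_ : to_complex U^T *m _ =
       to_complex (diag_mx s *m (U^T *m C *m V)^T)); last first.
  by rewrite /to_complex -!map_mxM {1}ME !mulmxA UtU mul1mx !trmx_mul trmxK !mulmxA.
rewrite mul_diag_mx -(rmorph_nat (real_complex R)) -fmorphV Im_real_mul.
rewrite /mxtrace Im_sum mulr_sumr; apply: eq_bigr => j _.
rewrite mul_diag_mx !mxE; set c := \sum_ _ _.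
rewrite [X in complex.Im X]mulrC [s 0 j * c]mulrC rmorphM -[X in complex.Im X]mulrA.
by rewrite Im_real_mul Im_real_div //; ring.
Qed.

End Resolvent.

(** * Both limits for a fixed realization of the sample *)

Theorem proposition2p1 (R : realType) (n p T : nat)
    (n_le_p : (n <= p)%N) (T_gt0 : (0 < T)%N)
    (A : 'M[R]_n) (B : 'M[R]_p) (C : 'M[R]_(n, p))
    (Sigma_nonneg : nonneg_definite (block_mx A C C^T B))
    (d0 : measure_display) (Omega0 : measurableType d0)
    (P0 : probability Omega0 R)
    (X0 : Omega0 -> 'cV[R]_n) (Y0 : Omega0 -> 'cV[R]_p)
    (XY_gaussian : centered_gaussian P0 (fun w => col_mx (X0 w) (Y0 w))
                     (block_mx A C C^T B))
    (d : measure_display) (Omega : measurableType d) (P : probability Omega R)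
    (X : 'I_T -> Omega -> 'cV[R]_n) (Y : 'I_T -> Omega -> 'cV[R]_p)
    (XY_copies : independent_copies P0 P (fun w => col_mx (X0 w) (Y0 w))
                   (fun t w => col_mx (X t w) (Y t w)))
    (w : Omega) (U : 'M[R]_n) (s : 'rV[R]_n) (V : 'M[R]_(p, n))
    (CXY_svd : is_svd (empirical_cross_cov X Y w) U s V) :
  (exists scleaned : 'rV[R]_n, is_cleaned U V C scleaned) /\
  forall scleaned : 'rV[R]_n, is_cleaned U V C scleaned ->
  forall k : 'I_n,
    scleaned 0 k = ((col k U)^T *m C *m col k V) 0 0 /\
    (0 < s 0 k -> simple_at s k ->
      (pointwise_ratio T (empirical_cross_cov X Y w) C (s 0 k) eta
         @[eta --> (0 : R)^'] --> scleaned 0 k) /\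
      (forall eps : R, 0 < eps ->
        `[s 0 k - eps, s 0 k + eps] `&` [set s 0 j | j in [set: 'I_n]]
          = [set s 0 k] ->
        eps < 2 * s 0 k ->
        integral_ratio T (empirical_cross_cov X Y w) C
            (s 0 k - eps) (s 0 k + eps) eta
          @[eta --> (0 : R)^'] --> scleaned 0 k)).
Proof.
case: (CXY_svd) => s_ge0 UtU VtV _.
have cleanP := is_cleanedP UtU VtV C.
split; first by exists (overlap U V C); apply/cleanP.
move=> scleaned /cleanP -> {scleaned} k; split; first exact: overlapE.
move=> sk_gt0 sk_simple.
(* The factor common to L and z G: 1/T normalizes the trace, 1/2 comes from partial fractions and
   the sign from Im of 1/(x + i eta). It is nonzero as T > 0 and cancels in the ratios. *)
pose kappa : R := - 2^-1 * T%:R^-1.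
have kappa0 : kappa != 0.
  by rewrite mulf_neq0 ?oppr_eq0 ?invr_eq0 ?pnatr_eq0 // -lt0n.
have eta_neq0 : \forall eta \near (0 : R)^', eta != 0.
  exact: nbhs_dnbhs_neq.
have LE := Im_Lfun T CXY_svd C; have GE := Im_zGfun T CXY_svd.
have ckE : (kappa *: overlap U V C) 0 k = overlap U V C 0 k * kappa.
  by rewrite mxE mulrC.
have kE : (const_mx kappa : 'rV_n) 0 k = kappa by rewrite mxE.
split=> [|e e0 gap e2].
  have limit v sigma :=
    @cvg_pole_sum R n s v sigma k s_ge0 sk_gt0 sk_simple.
  apply: (@cvg_common_factor _ _ _ _ id _ _ _ kappa) => //.
    rewrite -ckE; apply: cvg_trans (limit _ (-1)).
    by apply: near_eq_cvg; near=> eta; rewrite LE //; near: eta.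
  rewrite -[X in _ --> X]kE; apply: cvg_trans (limit _ 1).
  by apply: near_eq_cvg; near=> eta; rewrite GE //; near: eta.
(* The isolation condition on values becomes a distance bound on indices; simplicity turns s_j = s_k
   into j = k. *)
have {}gap j : j != k -> e < `|s 0 k - s 0 j|.
  move=> jk; rewrite ltNge; apply/negP => le_e.
  have : [set s 0 k] (s 0 j).
    rewrite -gap; split; last by exists j.
    by rewrite /= in_itv /=; move: le_e; rewrite ler_norml; lra.
  by move=> /sk_simple jk'; rewrite jk' eqxx in jk.
have limit v sigma := @cvg_Rintegral_pole_sum R n s v sigma k e
  s_ge0 sk_gt0 e0 gap e2.
apply: (@cvg_common_factor _ _ _ _ Num.sg _ _ _ (kappa * pi)).
- by near=> eta; rewrite sgr_eq0; near: eta.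
- by rewrite mulf_neq0 // gt_eqF // pi_gt0.
- rewrite mulrA -ckE; apply: cvg_trans (limit _ (-1)).
  apply: near_eq_cvg; near=> eta; congr (_ * _).
  by apply: eq_Rintegral => x _; rewrite LE //; near: eta.
- rewrite -[X in X * pi]kE; apply: cvg_trans (limit _ 1).
  apply: near_eq_cvg; near=> eta; congr (_ * _).
  by apply: eq_Rintegral => x _; rewrite GE //; near: eta.
Unshelve. all: by end_near.
Qed.
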